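(* Let $p$ be a prime, let $|\cdot|_\infty$ be the usual absolute value and $|\cdot|_p$ the $p$-adic absolute value on $\mathbb{Q}$, let $b\in\mathbb{Q}\cap(\mathbb{Z}_p\setminus\mathbb{Z})$, and consider the power series $$\sum_{n=0}^{\infty}\frac{b(b-1)\cdots(b-n+1)}{n!}x^n .$$ (i) The radius of convergence of this power series is equal to $1$ with respect to the usual absolute value, and it is also equal to $1$ with respect to the $p$-adic absolute value. (ii) The set of rational numbers $x$ at which the power series converges both with respect to the usual absolute value and with respect to the $p$-adic absolute value within the common radius of convergence $1$, i.e. the set of $x\in\mathbb{Q}$ belonging to both $\{x\in\mathbb{Q}:|x|_\infty<1\}$ and $\{x\in\mathbb{Q}:|x|_p<1\}$ (at which the power series converges in $\mathbb{R}$ and in $\mathbb{Q}_p$), is $$\Big\{x\in\mathbb{Q}: x=\tfrac{u}{v},\ u,v\in\mathbb{Z},\ (u,v)=1,\ |u|_\infty\le|v|_\infty,\ p\mid u,\ p\nmid v\Big\}.$$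
   Context: $\mathbb{Q}_p$ is the field of $p$-adic numbers and $\mathbb{Z}_p$ the ring of $p$-adic integers; $|\cdot|_p$ is normalized by $|p^k\frac{a}{d}|_p=p^{-k}$ for integers $a,d$ not divisible by $p$, and $|0|_p=0$. The $n=0$ coefficient of the series is $1$. The radius of convergence $R$ of $\sum a_nx^n$ with respect to an absolute value $|\cdot|$ is given by $1/R=\limsup_{n\to\infty}|a_n|^{1/n}$. $(u,v)$ denotes the greatest common divisor. *)

(* Defs.v *)
From HB Require Import structures.
From mathcomp Require Import all_boot all_order all_algebra ring.
From mathcomp Require Import generic_quotient ring_quotient.
From mathcomp Require Import all_classical all_reals all_analysis.

Set Implicit Arguments.
Unset Strict Implicit.
Unset Printing Implicit Defensive.

Import Order.TTheory GRing.Theory Num.Theory.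
Import numFieldNormedType.Exports.

Local Open Scope classical_set_scope.
Local Open Scope ring_scope.

(* The values of the p-adic absolute value are powers of p, so it is kept
   rational-valued; it is the p-adic absolute value only for p prime. *)
Definition padic_val (p : nat) (x : rat) : int :=
  (logn p `|numq x|%N)%:Z - (logn p `|denq x|%N)%:Z.

Definition padic_abs (p : nat) (x : rat) : rat :=
  if x == 0 then 0 else p%:R ^ (- padic_val p x).

Section PadicAbs.
Variables (p : nat) (p_pr : prime p).
Local Notation abs := (padic_abs p).

Let p_gt0 : (0 : rat) < p%:R. Proof. by rewrite ltr0n prime_gt0. Qed.
Let p_ge1 : (1 : rat) <= p%:R. Proof. by rewrite ler1n prime_gt0. Qed.
Let p_gt1 : (1 : rat) < p%:R. Proof. by rewrite ltr1n prime_gt1. Qed.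

Lemma padic_abs0 : abs 0 = 0. Proof. by rewrite /padic_abs eqxx. Qed.

Lemma padic_abs_ge0 x : 0 <= abs x.
Proof. by rewrite /padic_abs; case: ifP => // _; rewrite exprz_ge0 // ltW. Qed.

Lemma padic_abs_eq0 x : (abs x == 0) = (x == 0).
Proof.
rewrite /padic_abs; case: ifP => // _.
by rewrite expfz_eq0 (gt_eqF p_gt0) andbF.
Qed.

Lemma padic_val_frac (a d : int) : a != 0 -> d != 0 ->
  padic_val p (a%:Q / d%:Q) = (logn p `|a|%N)%:Z - (logn p `|d|%N)%:Z.
Proof.
move=> a0 d0; set x := _ / _.
have x0 : x != 0 by rewrite mulf_neq0 ?invr_eq0 ?intr_eq0.
have E : a * denq x = numq x * d.
  apply: (@intr_inj rat); rewrite !intrM.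
  have : x * d%:Q = a%:Q by rewrite mulfVK ?intr_eq0.
  rewrite -{1}(divq_num_den x) => <-.
  by rewrite mulrAC mulfVK // intr_eq0 denq_neq0.
have := congr1 (fun z : int => logn p `|z|%N) E.
rewrite !abszM !lognM ?absz_gt0 ?numq_eq0 ?denq_neq0 // => /(congr1 Posz).
rewrite !PoszD /padic_val => E2; apply/eqP.
by rewrite subr_eq addrAC eq_sym subr_eq E2.
Qed.

Lemma padic_absM x y : abs (x * y) = abs x * abs y.
Proof.
have [->|x0] := eqVneq x 0; first by rewrite mul0r padic_abs0 mul0r.
have [->|y0] := eqVneq y 0; first by rewrite mulr0 padic_abs0 mulr0.
rewrite /padic_abs mulf_eq0 (negPf x0) (negPf y0) /= -expfzDr ?gt_eqF //.
congr (_ ^ _); rewrite -opprD; congr (- _).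
have -> : x * y = (numq x * numq y)%:Q / (denq x * denq y)%:Q.
  by rewrite !intrM invfM mulrACA !divq_num_den.
rewrite padic_val_frac ?mulf_neq0 ?numq_eq0 ?denq_neq0 //.
rewrite !abszM !lognM ?absz_gt0 ?numq_eq0 ?denq_neq0 // !PoszD opprD.
by rewrite addrACA.
Qed.

Lemma padic_absN x : abs (- x) = abs x.
Proof. by rewrite /padic_abs oppr_eq0 /padic_val numqN denqN abszN. Qed.

Lemma padic_abs1 : abs 1 = 1.
Proof.
rewrite /padic_abs oner_eq0 /padic_val.
by rewrite (_ : numq 1 = 1) // (_ : denq 1 = 1) // subrr oppr0 expr0z.
Qed.

Lemma padic_absV x : abs x^-1 = (abs x)^-1.
Proof.
have [->|x0] := eqVneq x 0; first by rewrite !(invr0, padic_abs0).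
have nx0 : abs x != 0 by rewrite padic_abs_eq0.
by apply: (mulfI nx0); rewrite -padic_absM !divff // padic_abs1.
Qed.

Lemma padic_abs_unit (a : int) : ~~ (p %| `|a|)%N -> abs a%:Q = 1.
Proof.
move=> pa; have a0 : a != 0 by apply: contraNneq pa => ->; rewrite dvdn0.
rewrite -(divr1 a%:Q) -[1]/(1%:Q) /padic_abs mulf_eq0 invr_eq0 !intr_eq0.
rewrite (negPf a0) /= padic_val_frac // logn1 subr0 lognE (negPf pa) !andbF.
by rewrite oppr0 expr0z.
Qed.

Lemma padic_abs_p : abs p%:R = p%:R^-1.
Proof.
have pz : p%:Z != 0 by rewrite eqz_nat -lt0n prime_gt0.
have E : p%:R = p%:Z%:Q / 1%:Q by rewrite divr1 -pmulrn.
rewrite /padic_abs (gt_eqF p_gt0) E padic_val_frac // -E absz_nat logn1 subr0.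
by rewrite logn_prime // eqxx -exprnN expr1.
Qed.

Lemma padic_abs_exp (k : int) : abs (p%:R ^ k) = p%:R ^ (- k).
Proof.
have H n : abs (p%:R ^+ n) = p%:R ^- n.
  elim: n => [|n IHn]; first by rewrite expr0 padic_abs1 invr1.
  by rewrite !exprS padic_absM IHn padic_abs_p invfM.
case: k => n; first by rewrite -exprnP H exprnN.
by rewrite NegzE -exprnN padic_absV H invrK opprK.
Qed.

Lemma padic_abs_frac (k a d : int) : ~~ (p %| `|a|)%N -> ~~ (p %| `|d|)%N ->
  abs (p%:R ^ k * (a%:Q / d%:Q)) = p%:R ^ (- k).
Proof.
move=> pa pd; rewrite !padic_absM padic_absV !padic_abs_unit // padic_abs_exp.
by rewrite invr1 !mulr1.
Qed.

Lemma padic_abs_int_le1 (a : int) : abs (a%:Q) <= 1.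
Proof.
have [->|a0] := eqVneq a 0; first by rewrite padic_abs0.
rewrite -(divr1 a%:Q) -[1]/(1%:Q) /padic_abs mulf_eq0 invr_eq0 !intr_eq0.
rewrite (negPf a0) /= padic_val_frac // logn1 subr0.
by rewrite -exprnN invf_le1 ?exprn_gt0 // exprn_ege1.
Qed.

Lemma padic_absD x y : abs (x + y) <= Num.max (abs x) (abs y).
Proof.
wlog le_xy : x y / abs x <= abs y.
  by move=> H; case/orP: (le_total (abs x) (abs y)) => /H //; rewrite addrC maxC.
rewrite (max_r le_xy).
have [y0|y0] := eqVneq y 0.
  by move: le_xy; rewrite y0 addr0 padic_abs0.
suff: abs (x / y + 1) <= 1.
  rewrite -[X in _ + X](divff y0) -mulrDl padic_absM padic_absV.
  by rewrite ler_pdivrMr ?mul1r // lt_def padic_abs_eq0 y0 padic_abs_ge0.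
have : abs (x / y) <= 1.
  rewrite padic_absM padic_absV ler_pdivrMr ?mul1r //.
  by rewrite lt_def padic_abs_eq0 y0 padic_abs_ge0.
move: (x / y) => z z1.
rewrite -{1}(divq_num_den z) -[X in _ + X](@divff _ (denq z)%:Q) ?intr_eq0 //.
rewrite -mulrDl -intrD padic_absM padic_absV.
have pd : ~~ (p %| `|denq z|)%N.
  apply/negP => pd.
  have pn : (p %| `|numq z|)%N.
    have [->|n0] := eqVneq (numq z) 0; first by rewrite dvdn0.
    move: z1; rewrite /padic_abs -numq_eq0 (negPf n0) /padic_val opprB.
    rewrite -{2}(expr0z (p%:R : rat)) ler_eXz2l // subr_le0 lez_nat => le1.
    have : (0 < logn p `|denq z|)%N.
      by rewrite logn_gt0 mem_primes p_pr pd absz_gt0 denq_neq0.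
    by move=> /leq_trans/(_ le1); rewrite logn_gt0 mem_primes => /and3P[].
  have := coprime_num_den z; rewrite /coprime => /eqP g1.
  have : (p %| gcdn `|numq z| `|denq z|)%N by rewrite dvdn_gcd pn.
  by rewrite g1 dvdn1 => /eqP p1; move: p_pr; rewrite p1.
rewrite (padic_abs_unit pd).
by rewrite invr1 mulr1 padic_abs_int_le1.
Qed.

Lemma padic_absB x y : abs (x - y) <= Num.max (abs x) (abs y).
Proof. by rewrite -(padic_absN y) padic_absD. Qed.

Lemma padic_abs_distC x y : abs (x - y) = abs (y - x).
Proof. by rewrite -opprB padic_absN. Qed.

End PadicAbs.

Section PadicCompletion.
Variables (p : nat) (p_pr : prime p).
Local Notation abs := (padic_abs p).
Local Open Scope quotient_scope.

(* Q_p is built as the ring of Cauchy sequences of rationals for the p-adic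
   absolute value, modulo the ideal of null sequences.  The phantom primality
   argument lets instance inference recover that p is prime. *)
Definition padic_cauchy (_ : prime p) : pred (nat -> rat) := fun u =>
  `[< forall e : rat, 0 < e -> exists N, forall m n, (N <= m)%N -> (N <= n)%N ->
        abs (u m - u n) < e >].

Lemma padic_cauchyP u : reflect (forall e : rat, 0 < e -> exists N, forall m n,
  (N <= m)%N -> (N <= n)%N -> abs (u m - u n) < e) (u \in padic_cauchy p_pr).
Proof. exact: asboolP. Qed.

Lemma padic_cauchy_bounded u : u \in padic_cauchy p_pr ->
  exists N (M : rat), 0 < M /\ forall n, (N <= n)%N -> abs (u n) <= M.
Proof.
move=> /padic_cauchyP/(_ 1 ltr01)[N HN]; exists N, (Num.max 1 (abs (u N))).
split=> [|n Nn]; first by rewrite lt_max ltr01.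
rewrite -[u n](subrK (u N)) (le_trans (padic_absD p_pr _ _)) //.
by rewrite ge_max !le_max lexx orbT andbT (ltW (HN _ _ Nn _)).
Qed.

Lemma padic_cauchy_subring : subring_closed (padic_cauchy p_pr).
Proof.
split.
- by apply/padic_cauchyP => e e0; exists 0%N => m n _ _; rewrite subrr padic_abs0.
- move=> u v /padic_cauchyP Hu /padic_cauchyP Hv; apply/padic_cauchyP => e e0.
  have [N HN] := Hu e e0; have [K HK] := Hv e e0.
  exists (maxn N K) => m n; rewrite !geq_max => /andP[Nm Km] /andP[Nn Kn].
  have -> : (u - v) m - (u - v) n = (u m - u n) - (v m - v n).
    by rewrite !fctE; ring.
  by rewrite (le_lt_trans (padic_absB p_pr _ _)) // gt_max HN ?HK.
- move=> u v Hu Hv.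
  have [N1 [M [M0 HM]]] := padic_cauchy_bounded Hu.
  have [N2 [L [L0 HL]]] := padic_cauchy_bounded Hv.
  move/padic_cauchyP: Hu => Hu; move/padic_cauchyP: Hv => Hv.
  apply/padic_cauchyP => e e0.
  have [N3 H3] := Hu (e / L) (divr_gt0 e0 L0).
  have [N4 H4] := Hv (e / M) (divr_gt0 e0 M0).
  exists (maxn (maxn N1 N2) (maxn N3 N4)) => m n; rewrite !geq_max.
  move=> /andP[/andP[m1 m2] /andP[m3 m4]] /andP[/andP[n1 n2] /andP[n3 n4]].
  have -> : (u * v) m - (u * v) n = u m * (v m - v n) + v n * (u m - u n).
    by rewrite !fctE; ring.
  rewrite (le_lt_trans (padic_absD p_pr _ _)) // gt_max !padic_absM //.
  rewrite (@le_lt_trans _ _ (M * abs (v m - v n))) /=; last 2 first.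
  + by rewrite ler_wpM2r ?padic_abs_ge0 ?HM.
  + by rewrite mulrC -ltr_pdivlMr ?H4.
  rewrite (@le_lt_trans _ _ (L * abs (u m - u n))) //.
  + by rewrite ler_wpM2r ?padic_abs_ge0 ?HL.
  + by rewrite mulrC -ltr_pdivlMr ?H3.
Qed.

HB.instance Definition _ :=
  GRing.isSubringClosed.Build _ (padic_cauchy p_pr) padic_cauchy_subring.

Record cauchy_seq := CauchySeq {
  cauchy_val :> nat -> rat;
  _ : cauchy_val \in padic_cauchy p_pr }.

HB.instance Definition _ := [isSub for cauchy_val].
HB.instance Definition _ := [Choice of cauchy_seq by <:].
HB.instance Definition _ := [SubChoice_isSubComNzRing of cauchy_seq by <:].

Definition padic_null : pred cauchy_seq := fun u =>
  `[< forall e : rat, 0 < e -> exists N, forall n, (N <= n)%N -> abs (u n) < e >].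

Lemma padic_nullP (u : cauchy_seq) : reflect (forall e : rat, 0 < e -> exists N, forall n,
  (N <= n)%N -> abs (u n) < e) (u \in padic_null).
Proof. exact: asboolP. Qed.

Lemma padic_null_ideal : idealr_closed padic_null.
Proof.
split.
- by apply/padic_nullP => e e0; exists 0%N => n _; rewrite /= padic_abs0.
- apply/negP => /padic_nullP/(_ 1 ltr01)[N /(_ N (leqnn N))].
  by rewrite /= padic_abs1 ltxx.
- move=> a u v /padic_nullP Hu /padic_nullP Hv; apply/padic_nullP => e e0.
  have [N1 [M [M0 HM]]] := padic_cauchy_bounded (valP a).
  have [N2 H2] := Hu (e / M) (divr_gt0 e0 M0).
  have [N3 H3] := Hv e e0.
  exists (maxn N1 (maxn N2 N3)) => n; rewrite !geq_max => /and3P[n1 n2 n3].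
  rewrite /= (le_lt_trans (padic_absD p_pr _ _)) // gt_max H3 // andbT.
  rewrite padic_absM // (@le_lt_trans _ _ (M * abs (u n))) //.
  + by rewrite ler_wpM2r ?padic_abs_ge0 ?HM.
  + by rewrite mulrC -ltr_pdivlMr ?H2.
Qed.

HB.instance Definition _ := isIdealr.Build _ padic_null padic_null_ideal.

Definition Qp := {ideal_quot (padic_null : idealr cauchy_seq)}.
HB.instance Definition _ := GRing.ComNzRing.on Qp.

Definition Qp_class (u : cauchy_seq) : Qp := \pi_Qp u.

Lemma Qp_class_eq u v : (Qp_class u == Qp_class v) = (u - v \in padic_null).
Proof. by rewrite -Quotient.idealrBE. Qed.

Lemma Qp_classK (x : Qp) : Qp_class (repr x) = x.
Proof. exact: reprK. Qed.

Fact Qp_class_zmod : zmod_morphism Qp_class.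
Proof. exact: (rmorphB (\pi_({ideal_quot (padic_null : idealr cauchy_seq)}))). Qed.

Fact Qp_class_monoid : monoid_morphism Qp_class.
Proof.
split; first exact: (rmorph1 (\pi_({ideal_quot (padic_null : idealr cauchy_seq)}))).
exact: (rmorphM (\pi_({ideal_quot (padic_null : idealr cauchy_seq)}))).
Qed.

HB.instance Definition _ :=
  GRing.isZmodMorphism.Build cauchy_seq Qp Qp_class Qp_class_zmod.
HB.instance Definition _ :=
  GRing.isMonoidMorphism.Build cauchy_seq Qp Qp_class Qp_class_monoid.

Lemma padic_null_away u : u \notin padic_null ->
  exists e : rat, 0 < e /\ exists N, forall n, (N <= n)%N -> e <= abs (u n).
Proof.
move=> /asboolPn/existsNP[e /not_implyP[e0 /forallNP H]]; exists e; split=> //.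
have [N HN] := padic_cauchyP _ (valP u) e e0; exists N => n Nn.
have /existsNP[k /not_implyP[Nk /negP]] := H N; rewrite -leNgt => ek.
rewrite leNgt; apply/negP => une; move: ek; apply/negP; rewrite -ltNge.
rewrite -[u k](subrK (u n)) (le_lt_trans (padic_absD p_pr _ _)) //.
by rewrite gt_max une andbT; exact: HN.
Qed.

Lemma padic_cauchy_inv (u : cauchy_seq) : u \notin padic_null ->
  (fun n => (u n)^-1) \in padic_cauchy p_pr.
Proof.
move=> /padic_null_away[d [d0 [N HN]]]; apply/padic_cauchyP => e e0.
have [K HK] := padic_cauchyP _ (valP u) (e * (d * d)) (mulr_gt0 e0 (mulr_gt0 d0 d0)).
exists (maxn N K) => m n; rewrite !geq_max => /andP[Nm Km] /andP[Nn Kn].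
have nz k : (N <= k)%N -> u k != 0.
  by move=> /HN /(lt_le_trans d0); rewrite lt_def padic_abs_eq0 // => /andP[].
have -> : (u m)^-1 - (u n)^-1 = (u n - u m) / (u m * u n).
  by have := nz m Nm; have := nz n Nn => ? ?; field; apply/andP; split.
rewrite padic_absM // padic_absV // ltr_pdivrMr; last first.
  by rewrite padic_absM // mulr_gt0 // (lt_le_trans d0) ?HN.
rewrite (lt_le_trans (HK n m Kn Km)) // ler_pM2l // padic_absM //.
by rewrite ler_pM ?HN // ltW.
Qed.

Definition Qp_inv (x : Qp) : Qp :=
  if x == 0 then 0 else Qp_class (insubd 0 (fun n => (repr x n)^-1)).

Fact Qp_mulVf (x : Qp) : x != 0 -> Qp_inv x * x = 1.
Proof.
move=> x0; rewrite /Qp_inv (negPf x0).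
have xN : repr x \notin padic_null.
  by rewrite -[repr x]subr0 -Qp_class_eq Qp_classK rmorph0.
rewrite -{2}[x]Qp_classK -rmorphM -(rmorph1 Qp_class); apply/eqP.
rewrite Qp_class_eq; apply/padic_nullP => e e0.
have [d [d0 [N HN]]] := padic_null_away xN; exists N => n Nn.
have nz : repr x n != 0.
  by have := lt_le_trans d0 (HN n Nn); rewrite lt_def padic_abs_eq0 // => /andP[].
have -> : (insubd 0 (fun n => (repr x n)^-1) * repr x - 1 : cauchy_seq) n =
  val (insubd (0 : cauchy_seq) (fun n => (repr x n)^-1)) n * repr x n - 1 by [].
by rewrite insubdK ?padic_cauchy_inv // mulVf // subrr padic_abs0.
Qed.

Fact Qp_inv0 : Qp_inv 0 = 0.
Proof. by rewrite /Qp_inv eqxx. Qed.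

HB.instance Definition _ := GRing.ComNzRing_isField.Build Qp Qp_mulVf Qp_inv0.

Fact padic_cauchy_cst (q : rat) : (fun=> q) \in padic_cauchy p_pr.
Proof.
by apply/padic_cauchyP => e e0; exists 0%N => m n _ _; rewrite subrr padic_abs0.
Qed.

Definition cauchy_cst (q : rat) : cauchy_seq := CauchySeq (padic_cauchy_cst q).

Fact cauchy_cst_zmod : zmod_morphism cauchy_cst.
Proof. by move=> x y; apply: val_inj. Qed.

Fact cauchy_cst_monoid : monoid_morphism cauchy_cst.
Proof. by split=> [|x y]; apply: val_inj. Qed.

HB.instance Definition _ :=
  GRing.isZmodMorphism.Build rat cauchy_seq cauchy_cst cauchy_cst_zmod.
HB.instance Definition _ :=
  GRing.isMonoidMorphism.Build rat cauchy_seq cauchy_cst cauchy_cst_monoid.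

Lemma Qp_ratrE (q : rat) : ratr q = Qp_class (cauchy_cst q).
Proof. by rewrite -(fmorph_eq_rat (Qp_class \o cauchy_cst)). Qed.

Variable R : realType.

(* The sequence |u_n|_p is Cauchy in R whenever u is p-adically Cauchy, so this
   limit exists; it does not depend on the representative (Qp_norm_class). *)
Definition Qp_norm (x : Qp) : R := limn (fun n => ratr (abs (repr x n)) : R).

Lemma Qp_norm_class (u : cauchy_seq) (l : R) :
  (fun n => ratr (abs (u n)) : R) @ \oo --> l -> Qp_norm (Qp_class u) = l.
Proof.
move=> ul; apply: cvg_lim => //.
set v := repr (Qp_class u).
have : v - u \in padic_null by rewrite -Qp_class_eq Qp_classK.
move=> /padic_nullP vu.
have d0 : (fun n => ratr (abs (v n)) - ratr (abs (u n)) : R) @ \oo --> (0 : R).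
  apply/cvgrPdist_lt => e e0.
  have [q] := rat_in_itvoo e0; rewrite in_itv /= => /andP[q0 qe].
  rewrite ltr0q in q0; have [N HN] := vu q q0.
  near=> n; rewrite sub0r normrN -rmorphB /= -ratr_norm.
  apply: lt_trans qe; rewrite ltr_rat.
  have /HN h : (N <= n)%N by near: n; exists N.
  apply: le_lt_trans h.
  have tri x y : abs x <= abs (x - y) + abs y.
    rewrite -{1}[x](subrK y) (le_trans (padic_absD p_pr _ _)) //.
    by rewrite ge_max lerDl lerDr !padic_abs_ge0.
  have := tri (v n) (u n); have := tri (u n) (v n).
  rewrite (padic_abs_distC p) ler_norml => vu1 uv1.
  by rewrite lerBlDr uv1 andbT lerNl opprB lerBlDr.
rewrite -(add0r l); apply: cvg_trans (cvgD d0 ul).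
by apply: near_eq_cvg; near=> n; rewrite /= subrK.
Unshelve. all: by end_near. Qed.

Lemma Qp_norm_ratr (q : rat) : Qp_norm (ratr q) = ratr (abs q).
Proof.
by rewrite Qp_ratrE; apply: Qp_norm_class; apply: cvg_cst; exact: eventually_filter.
Qed.

Definition padic_integers : set Qp := [set z | Qp_norm z <= 1].

Definition Qp_cvgn (u : nat -> Qp) : Prop :=
  exists l : Qp, (fun n => Qp_norm (u n - l)) @ \oo --> (0 : R).

End PadicCompletion.

(* n = 0 contributes the junk exponent 0^-1 = 0, which does not affect the
   limsup; in \bar R one has 0^-1 = +oo and (+oo)^-1 = 0. *)
Definition radius_of_convergence (R : realType) (nrm : rat -> R)
    (a : nat -> rat) : \bar R :=
  ((limn_esup (fun n => (nrm (a n) `^ n%:R^-1)%:E))^-1)%E.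

Definition usual_norm (R : realType) (q : rat) : R := ratr `|q|.

Definition padic_norm (R : realType) (p : nat) (q : rat) : R :=
  ratr (padic_abs p q).

Definition binom_coef (b : rat) (n : nat) : rat :=
  (\prod_(i < n) (b - i%:R)) / n`!%:R.

Definition cvg_in_R (R : realType) (a : nat -> rat) (x : rat) : Prop :=
  cvgn (series (fun n => ratr (a n * x ^+ n) : R)).

Definition cvg_in_Qp (R : realType) (p : nat) (p_pr : prime p)
    (a : nat -> rat) (x : rat) : Prop :=
  Qp_cvgn R (series (fun n => ratr (a n * x ^+ n) : Qp p_pr)).

(* Main.v *)
(* The ratio of consecutive coefficients is (b - n)/(n + 1), which tends to -1,
   so the n-th roots of their usual absolute values tend to 1.  p-adically the
   coefficients lie in Z_p, because b is a p-adic limit of natural numbers m and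
   C(m, n) is an integer.  Moreover, if n is the residue of b modulo p^k then
   b - i and n - i have the same valuation for i < n, so the coefficient of
   index n is a p-adic unit; such n are unbounded because b is not a natural
   number, hence the limsup is 1.  On Q_p the series converges as soon as its
   terms tend to 0. *)
Require Import Defs.
From mathcomp Require Import all_boot all_order all_algebra ring lra.
From mathcomp Require Import all_classical all_reals all_analysis.
Import Order.TTheory GRing.Theory Num.Theory.
Import numFieldNormedType.Exports.
Local Open Scope classical_set_scope.
Local Open Scope ring_scope.

(** * Divisibility and approximation for the [p]-adic absolute value on the rationals *)

Section PadicRationals.
Set Implicit Arguments.
Unset Strict Implicit.
Variables (p : nat) (p_pr : prime p).
Local Notation abs := (padic_abs p).

Lemma padic_absX x n : abs (x ^+ n) = abs x ^+ n.
Proof.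
by elim: n => [|n IH]; rewrite ?expr0 ?padic_abs1 // !exprS padic_absM // IH.
Qed.

Lemma padic_abs_nat (n : nat) : (0 < n)%N ->
  abs n%:R = ((p ^ logn p n)%:R)^-1.
Proof.
move=> n0; have nz : n%:Z != 0 by rewrite eqz_nat -lt0n.
have E : n%:R = n%:Z%:Q / 1%:Q by rewrite divr1 -pmulrn.
rewrite /padic_abs pnatr_eq0 (negPf (lt0n_neq0 n0)).
by rewrite E padic_val_frac // absz_nat logn1 subr0 -exprnN natrX.
Qed.

(** The largest power of [p] dividing [n] is at most [n], hence below [p ^ k]. *)
Lemma padic_abs_nat_gt (n k : nat) : (0 < n < p ^ k)%N ->
  ((p ^ k)%:R)^-1 < abs n%:R.
Proof.
move=> /andP[n0 nk]; rewrite padic_abs_nat // ltf_pV2 ?posrE ?ltr0n ?expn_gt0 ?prime_gt0 //.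
by rewrite ltr_nat (leq_ltn_trans _ nk) // dvdn_leq ?pfactor_dvdnn.
Qed.

Lemma padic_abs_dvd (m : int) (k : nat) : ((p ^ k)%:Z %| m)%Z ->
  abs m%:~R <= ((p ^ k)%:R)^-1.
Proof.
move=> /dvdzP[q ->]; rewrite intrM padic_absM // -pmulrn.
rewrite (@padic_abs_nat (p ^ k)) ?expn_gt0 ?prime_gt0 // pfactorK //.
by rewrite ler_piMl ?invr_ge0 ?ler0n // padic_abs_int_le1.
Qed.

Lemma padic_abs_int_lt1 (a : int) : (abs a%:~R < 1) = (p%:Z %| a)%Z.
Proof.
have [|pa] := boolP (p%:Z %| a)%Z; last by rewrite padic_abs_unit // ltxx.
rewrite -{1}(expn1 p) => /padic_abs_dvd/le_lt_trans -> //.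
by rewrite expn1 invf_lt1 ?ltr1n ?ltr0n ?prime_gt0 ?prime_gt1.
Qed.

Lemma coprimez_prime_dvd (u v : int) :
  coprimez u v -> (p%:Z %| u)%Z -> ~~ (p%:Z %| v)%Z.
Proof.
rewrite coprimezE => cop pu; apply/negP => pv.
have := coprime_dvdl pu (coprime_dvdr pv cop).
by rewrite /coprime gcdnn => /eqP p1; move: p_pr; rewrite -[p]/`|p%:Z|%N p1.
Qed.

Lemma padic_abs_frac_lt1 (u v : int) : v != 0 -> coprimez u v ->
  (abs (u%:~R / v%:~R) < 1) = (p%:Z %| u)%Z.
Proof.
move=> v0 cop; rewrite padic_absM // padic_absV // -padic_abs_int_lt1.
have vgt0 : 0 < abs v%:~R by rewrite lt_def padic_abs_eq0 // intr_eq0 v0 padic_abs_ge0.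
have [pu|pu] := boolP (p%:Z %| u)%Z.
  by rewrite (padic_abs_unit (a := v)) ?invr1 ?mulr1 // (coprimez_prime_dvd cop).
rewrite (padic_abs_unit pu) // mul1r invf_lt1 // ltxx ltNge.
by rewrite padic_abs_int_le1.
Qed.

(** If [p] divided the denominator, the coprime numerator would be a unit and the quotient would
    have absolute value above 1. *)
Lemma padic_abs_le1_denq x : abs x <= 1 -> ~~ (p%:Z %| denq x)%Z.
Proof.
rewrite -{1}(divq_num_den x) padic_absM // padic_absV // => x1; apply/negP => pd.
have pn : ~~ (p%:Z %| numq x)%Z.
  by apply: coprimez_prime_dvd pd; rewrite coprimez_sym coprimezE coprime_num_den.
move: x1; rewrite (padic_abs_unit pn) // mul1r leNgt invf_gt1 ?padic_abs_int_lt1 ?pd //.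
by rewrite lt_def padic_abs_eq0 // intr_eq0 denq_neq0 padic_abs_ge0.
Qed.

(** Ultrametric isosceles principle: if [abs x < abs y], then [y = (y - x) + x] would be a sum of
    two terms smaller than [y]. *)
Lemma padic_abs_near x y : abs (x - y) < abs y -> abs x = abs y.
Proof.
move=> xy; apply/eqP; rewrite eq_le; apply/andP; split.
  by rewrite -[x](subrK y) (le_trans (padic_absD p_pr _ _)) // ge_max lexx ltW.
rewrite leNgt; apply/negP => ltxy.
have := padic_absD p_pr (y - x) x; rewrite subrK padic_abs_distC leNgt.
by rewrite gt_max xy ltxy.
Qed.

(** Bezout inverts the denominator modulo [p ^ k]; the residue of the numerator times this inverse
    is the required natural number. *)
Lemma padic_approx_nat x k : abs x <= 1 ->
  exists n : nat, (n < p ^ k)%N /\ abs (x - n%:R) <= ((p ^ k)%:R)^-1.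
Proof.
move=> /padic_abs_le1_denq pd.
have cop : coprimez (denq x) (p ^ k)%:Z.
  by rewrite coprimezE /= coprime_sym coprimeXl // prime_coprime.
have pk0 : (p ^ k)%:Z != 0 by rewrite eqz_nat -lt0n expn_gt0 prime_gt0.
have [u [v uv]] := Bezoutz (denq x) (p ^ k)%:Z.
have {}uv : u * denq x + v * (p ^ k)%:Z = 1 by rewrite uv; apply/eqP.
pose r := ((numq x * u) %% (p ^ k)%:Z)%Z.
have r0 : 0 <= r by rewrite modz_ge0.
have rlt : r < (p ^ k)%:Z by rewrite ltz_pmod // ltz_nat expn_gt0 prime_gt0.
have rE : `|r|%N%:Z = r by rewrite gez0_abs.
exists `|r|%N; split; first by rewrite -ltz_nat rE.
have -> : x - `|r|%N%:R = (numq x - r * denq x)%:~R / (denq x)%:~R.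
  by rewrite -{1}(divq_num_den x) intrB intrM mulrBl mulfK ?intr_eq0 ?denq_neq0 // pmulrn rE.
rewrite padic_absM // padic_absV // (padic_abs_unit (a := denq x)) // invr1 mulr1.
apply: padic_abs_dvd; apply/dvdzP.
(* Comes from [numq x - r * denq x] by reducing [r] to [numq x * u] modulo [p ^ k] and replacing
   [1 - u * denq x] by [v * p ^ k]. *)
exists (numq x * v + denq x * ((numq x * u) %/ (p ^ k)%:Z)%Z).
have := divz_eq (numq x * u) (p ^ k)%:Z; rewrite -/r.
move: (_ %/ _)%Z => q E.
have -> : r = numq x * u - q * (p ^ k)%:Z by rewrite E addrC addKr.
by rewrite -[X in X - _]mulr1 -uv; ring.
Qed.

(** * Falling factorials and the [p]-adic size of binomial coefficients *)

Lemma prod_sub_ffact (F : comPzRingType) (m n : nat) :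
  \prod_(i < n) (m%:R - i%:R) = (m ^_ n)%:R :> F.
Proof.
elim: n => [|n IH]; first by rewrite big_ord0 ffactn0.
rewrite big_ord_recr /= IH ffactnSr natrM.
(* For [m < n] the truncated [m - n] differs from the ring subtraction, but [m ^_ n] already
   vanishes. *)
have [nm|mn] := leqP n m; first by rewrite natrB.
by rewrite ffact_small // !mul0r.
Qed.

(** All factors lie in the unit ball, so peeling them off one at a time never enlarges the
    difference beyond [abs (x - y)]. *)
Lemma padic_abs_prod_sub x y n : abs x <= 1 -> abs y <= 1 ->
  abs (\prod_(i < n) (x - i%:R) - \prod_(i < n) (y - i%:R)) <= abs (x - y).
Proof.
move=> x1 y1.
have sub1 z (i : nat) : abs z <= 1 -> abs (z - i%:R) <= 1.
  move=> z1; rewrite (le_trans (padic_absB p_pr _ _)) // ge_max z1.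
  by rewrite pmulrn padic_abs_int_le1.
have prod1 m : abs (\prod_(i < m) (x - i%:R)) <= 1.
  elim/big_rec: _ => [|i z _ z1]; first by rewrite padic_abs1.
  by rewrite padic_absM // mulr_ile1 ?padic_abs_ge0 ?sub1.
elim: n => [|n IH]; first by rewrite !big_ord0 subrr padic_abs0 padic_abs_ge0.
rewrite !big_ord_recr /=; set P := \prod_(i < n) _; set Q := \prod_(i < n) _.
have -> : P * (x - n%:R) - Q * (y - n%:R) = P * (x - y) + (y - n%:R) * (P - Q) by ring.
rewrite (le_trans (padic_absD p_pr _ _)) // ge_max !padic_absM //.
rewrite ler_piMl ?padic_abs_ge0 ?prod1 //=.
by rewrite (le_trans _ IH) // ler_piMl ?padic_abs_ge0 ?sub1.
Qed.

(* [b] is congruent to a natural number [m] modulo a power of [p] exceeding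
   [n`!], so the coefficient is p-adically close to the integer ['C(m, n)]. *)
Lemma padic_abs_binom_coef_le1 b n : abs b <= 1 -> abs (binom_coef b n) <= 1.
Proof.
move=> b1; have [m [_ bm]] := padic_approx_nat n`! b1.
have m1 : abs m%:R <= 1 by rewrite pmulrn padic_abs_int_le1.
have f0 : 0 < abs n`!%:R.
  by rewrite lt_def padic_abs_eq0 // pnatr_eq0 -lt0n fact_gt0 padic_abs_ge0.
have fgt : ((p ^ n`!)%:R)^-1 < abs n`!%:R.
  by apply: padic_abs_nat_gt; rewrite fact_gt0 ltn_expl ?prime_gt1.
rewrite padic_absM // padic_absV // ler_pdivrMr // mul1r.
rewrite -[X in abs X](subrK (\prod_(i < n) (m%:R - i%:R))).
rewrite (le_trans (padic_absD p_pr _ _)) // ge_max.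
rewrite (le_trans (padic_abs_prod_sub n b1 m1)) ?(le_trans bm) ?(ltW fgt) //=.
rewrite prod_sub_ffact -bin_ffact natrM padic_absM // ler_piMl ?padic_abs_ge0 //.
by rewrite pmulrn padic_abs_int_le1.
Qed.

(** For [i < n] the number [n - i] is positive and below [p ^ k], so its absolute value exceeds that
    of [b - n]. Hence [b - i] and [n - i] have equal size, and the numerator has the size of
    [n!]. *)
Lemma padic_abs_binom_coef_eq1 b (n k : nat) : (n < p ^ k)%N ->
  abs (b - n%:R) <= ((p ^ k)%:R)^-1 -> abs (binom_coef b n) = 1.
Proof.
move=> nk bn.
have step (i : nat) : (i < n)%N -> abs (b - i%:R) = abs (n%:R - i%:R).
  move=> lt_in; apply: padic_abs_near; rewrite opprB addrA subrK.
  rewrite (le_lt_trans bn) // -natrB 1?ltnW // padic_abs_nat_gt //.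
  by rewrite subn_gt0 lt_in (leq_ltn_trans (leq_subr _ _)).
have E : abs (\prod_(i < n) (b - i%:R)) = abs (\prod_(i < n) (n%:R - i%:R)).
  rewrite !(big_morph abs (padic_absM p_pr) (padic_abs1 p)).
  by apply: eq_bigr => i _; exact: step.
rewrite padic_absM // E -padic_absM // prod_sub_ffact ffactnn divff ?padic_abs1 //.
Qed.

(** As [b] differs from every [m < N], some [p ^ k] separates it from all of them; the residue of
    [b] modulo that power is then at least [N]. *)
Lemma padic_abs_binom_coef_inf b N : abs b <= 1 -> b \isn't a Num.int ->
  exists2 n, (N <= n)%N & abs (binom_coef b n) = 1.
Proof.
move=> b1 bZ.
have [k Hk] : exists k : nat, forall m, (m < N)%N -> ((p ^ k)%:R)^-1 < abs (b - m%:R).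
  elim: N => [|N [k Hk]]; first by exists 0%N.
  have bN : 0 < abs (b - N%:R).
    rewrite lt_def padic_abs_eq0 // padic_abs_ge0 andbT subr_eq0.
    by apply: contra bZ => /eqP ->; rewrite rpred_nat.
  have [j Hj] : exists j : nat, ((p ^ j)%:R)^-1 < abs (b - N%:R).
    (* Here [p ^ j > j], and [j] exceeds the inverse of [abs (b - N)]. *)
    exists (Num.trunc (abs (b - N%:R))^-1).+1; rewrite invf_plt ?posrE //.
      rewrite (lt_trans (truncnS_gt _)) // ltr_nat ltn_expl // prime_gt1 //.
    by rewrite ltr0n expn_gt0 prime_gt0.
  exists (maxn j k) => m; rewrite ltnS leq_eqVlt => mN.
  have le i : (i <= maxn j k)%N -> ((p ^ maxn j k)%:R)^-1 <= ((p ^ i)%:R)^-1 :> rat.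
    move=> le_i; rewrite lef_pV2 ?posrE ?ltr0n ?expn_gt0 ?prime_gt0 // ler_nat.
    by rewrite leq_pexp2l ?prime_gt0.
  case/orP: mN => [/eqP ->|/Hk]; first by rewrite (le_lt_trans _ Hj) // le ?leq_maxl.
  by apply: le_lt_trans; rewrite le ?leq_maxr.
have [n [nk bn]] := padic_approx_nat k b1; exists n.
  by rewrite leqNgt; apply/negP => /Hk; rewrite ltNge bn.
exact: padic_abs_binom_coef_eq1 bn.
Qed.

End PadicRationals.

(** * Limits superior, roots of coefficients and the root test over the reals *)

Section RootTest.
Context {R : realType}.
Implicit Types (u : R^nat) (l x : R).

(** Every tail has supremum exactly [l]. *)
Lemma limn_esup_attained (u : (\bar R)^nat) (l : \bar R) :
  (forall n, u n <= l)%E -> (forall N, exists2 n, (N <= n)%N & u n = l) ->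
  limn_esup u = l.
Proof.
move=> ul ulN; rewrite limn_esup_lim.
suff -> : esups u = cst l by apply: cvg_lim => //; exact: cvg_cst.
apply/funext => N; apply/eqP; rewrite eq_le; apply/andP; split.
  by apply: ge_ereal_sup => _ [n _ <-].
have [n Nn <-] := ulN N.
by apply: ereal_sup_ubound; exists n.
Qed.

(* The logarithm turns [u n.+1 / u n --> l] into a Cesaro mean. *)
Lemma cvg_root_of_ratio u l : (forall n, 0 < u n) -> 0 < l ->
  u n.+1 / u n @[n --> \oo] --> l -> u n `^ n%:R^-1 @[n --> \oo] --> l.
Proof.
(* The shift avoids the exponent [0^-1] and matches the divisor [n.+1] of the arithmetic mean. *)
move=> u0 l0 ul; rewrite -cvg_shiftS /=.
have r0 n : 0 < u n.+1 / u n by rewrite divr_gt0.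
have lnul : ln (u n.+1 / u n) @[n --> \oo] --> ln l.
  by apply: continuous_cvg ul; exact: continuous_ln.
have E : (fun n => u n.+1 `^ n.+1%:R^-1) =
    (fun n => expR (harmonic n * ln (u 0%N) +
                    arithmetic_mean (fun k => ln (u k.+1 / u k)) n)).
  apply/funext => n; rewrite /powR gt_eqF //; congr expR.
  rewrite /arithmetic_mean /harmonic /= -mulrDr; congr (_ * _).
  rewrite (eq_sum_telescope (fun k => ln (u k))) /series /=.
  by congr (_ + _); apply: eq_bigr => k _; rewrite ln_div ?posrE.
rewrite E; have -> : l = expR (0 + ln l) by rewrite add0r lnK ?posrE.
apply: continuous_cvg; first exact: continuous_expR.
apply: cvgD; last exact: cesaro.
rewrite -[X in _ --> X](mul0r (ln (u 0%N))).
by apply: cvgM; [exact: cvg_harmonic|exact: cvg_cst].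
Qed.

(** Root test: a ratio [r] strictly between [l * |x|] and 1 gives an eventual geometric majorant. *)
Lemma cvg_power_series (a : R^nat) l x :
  `|a n| `^ n%:R^-1 @[n --> \oo] --> l -> l * `|x| < 1 ->
  cvgn (series (fun n => a n * x ^+ n)).
Proof.
move=> al lx1; apply: normed_cvg.
have [r lr r1] : exists2 r, l * `|x| < r & r < 1.
  by exists ((l * `|x| + 1) / 2); lra.
have al' : `|a n| `^ n%:R^-1 * `|x| @[n --> \oo] --> l * `|x|.
  by apply: cvgM => //; exact: cvg_cst.
have [N _ HN] := cvgr_lt (l * `|x|) al' r lr.
have r0 : 0 <= r.
  by rewrite (le_trans _ (ltW (HN N _))) //= ?mulr_ge0 ?powR_ge0.
have Hr n : (N.+1 <= n)%N -> `|a n * x ^+ n| <= r ^+ n.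
  move=> Nn; have n0 : (0 < n)%N by apply: leq_trans Nn.
  have -> : `|a n * x ^+ n| = (`|a n| `^ n%:R^-1 * `|x|) ^+ n.
    rewrite normrM normrX exprMn -(powR_mulrn n (powR_ge0 _ _)) -powRrM.
    by rewrite mulVf ?powRr1 // pnatr_eq0 -lt0n.
  rewrite lerXn2r ?nnegrE ?mulr_ge0 ?powR_ge0 //.
  by apply: ltW; apply: HN => /=; exact: ltnW.
(* The comparison test asks for domination at every index, so the majorant copies the terms up to
   [N]. *)
pose v n := if (n <= N)%N then `|a n * x ^+ n| else r ^+ n.
have fv n : `|a n * x ^+ n| <= v n by rewrite /v; case: leqP => // /Hr.
apply: (@series_le_cvg _ _ v) => [n|n|//|] /=; first exact: normr_ge0.
  exact: le_trans (fv n).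
rewrite -(@is_cvg_series_restrict N.+1).
have -> : (fun n => \sum_(N.+1 <= k < n) v k) =
    (fun n => \sum_(N.+1 <= k < n) geometric 1 r k).
  apply/funext => n; apply: eq_big_nat => k /andP[Nk _].
  by rewrite /v leqNgt Nk /= mul1r.
rewrite is_cvg_series_restrict; apply: is_cvg_geometric_series.
by rewrite ger0_norm.
Qed.

End RootTest.

(** * Norms and convergent series in the completion *)

Section PadicCompletion.
Set Implicit Arguments.
Unset Strict Implicit.
Variables (p : nat) (p_pr : prime p) (R : realType).
Local Notation abs := (padic_abs p).

(** A null sequence has norms tending to 0; any other Cauchy sequence stays away from 0, so its
    absolute values are eventually constant by the isosceles principle. *)
Lemma Qp_norm_class_cvg (u : cauchy_seq p_pr) :
  (ratr (abs (u n)) : R) @[n --> \oo] --> Qp_norm R (Qp_class u).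
Proof.
suff [l ul] : exists l : R, (ratr (abs (u n)) : R) @[n --> \oo] --> l.
  by rewrite (Qp_norm_class ul).
have [/padic_nullP uN|/padic_null_away[e [e0 [N eu]]]] := boolP (u \in @padic_null p p_pr).
  exists 0; apply/cvgrPdist_lt => e e0.
  have [q] := rat_in_itvoo e0; rewrite in_itv /= => /andP[q0 qe].
  rewrite ltr0q in q0; have [N HN] := uN q q0.
  exists N => // n /= Nn.
  rewrite sub0r normrN ger0_norm ?ler0q ?padic_abs_ge0 //.
  by rewrite (lt_trans _ qe) // ltr_rat HN.
have [K uK] := padic_cauchyP p_pr _ (valP u) e e0.
exists (ratr (abs (u (maxn N K)))); apply: cvg_near_cst.
exists (maxn N K) => // n /=; rewrite geq_max => /andP[Nn Kn].
congr (ratr _); apply: padic_abs_near => //.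
by rewrite (lt_le_trans (uK _ _ _ _)) ?eu ?leq_maxl ?leq_maxr.
Qed.

(** By the ultrametric inequality a block of consecutive terms is no larger than its largest
    term. *)
Lemma padic_cauchy_series (a : nat -> rat) :
  (forall e, 0 < e -> exists N, forall n, (N <= n)%N -> abs (a n) < e) ->
  series a \in padic_cauchy p_pr.
Proof.
move=> a0; apply/padic_cauchyP => e e0; have [N HN] := a0 e e0.
have tail m k : (N <= m)%N -> abs (series a (m + k)%N - series a m) < e.
  move=> Nm; elim: k => [|k IH]; first by rewrite addn0 subrr padic_abs0.
  rewrite addnS -[series a _.+1](subrK (series a (m + k)%N)) -addrA.
  rewrite (le_lt_trans (padic_absD p_pr _ _)) // gt_max IH andbT.
  by rewrite seriesSB HN // (leq_trans Nm) // leq_addr.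
exists N => m n Nm Nn; wlog mn : m n Nm Nn / (m <= n)%N => [H|].
  by case/orP: (leq_total m n) => [/H|/H]; rewrite 1?padic_abs_distC; apply.
by rewrite padic_abs_distC -(subnKC mn) tail.
Qed.

(** The limit is the class of [u]: its distance to [u n] is the limit over [m] of [abs (u n - u m)],
    small for large [n] by the Cauchy property. *)
Lemma Qp_cvgn_class (u : cauchy_seq p_pr) :
  Qp_cvgn R (fun n => ratr (u n) : Qp p_pr).
Proof.
exists (Qp_class u); apply/cvgrPdist_le => e e0.
have [q] := rat_in_itvoo e0; rewrite in_itv /= => /andP[q0 qe].
rewrite ltr0q in q0; have [N HN] := padic_cauchyP p_pr _ (valP u) q q0.
exists N => // n /= Nn; rewrite sub0r normrN Qp_ratrE -rmorphB.
have := @Qp_norm_class_cvg (cauchy_cst p_pr (u n) - u) => ul.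
have n0 : 0 <= Qp_norm R (Qp_class (cauchy_cst p_pr (u n) - u)).
  rewrite -(cvg_lim _ ul) //; apply: limr_ge; first by apply/cvg_ex; eexists; exact: ul.
  by apply: nearW => m; rewrite ler0q padic_abs_ge0.
rewrite ger0_norm // -(cvg_lim _ ul) //.
apply: limr_le; first by apply/cvg_ex; eexists; exact: ul.
exists N => // m /= Nm; rewrite (le_trans _ (ltW qe)) // ler_rat ltW //.
exact: HN.
Qed.

End PadicCompletion.

(** * Radii and convergence of the binomial series *)

Section BinomialCoefficients.
Context {R : realType}.
Variable (b : rat).

Lemma binom_coefS n :
  binom_coef b n.+1 = binom_coef b n * ((b - n%:R) / n.+1%:R).
Proof.
by rewrite /binom_coef big_ord_recr /= factS mulnC natrM invfM mulrACA.
Qed.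

Lemma binom_coef_neq0 n : b \isn't a Num.int -> binom_coef b n != 0.
Proof.
move=> bZ; elim: n => [|n IH]; first by rewrite /binom_coef big_ord0 divr1 oner_eq0.
rewrite binom_coefS mulf_neq0 // mulf_neq0 ?invr_eq0 ?pnatr_eq0 // subr_eq0.
by apply: contra bZ => /eqP ->; rewrite rpred_nat.
Qed.

Lemma cvg_root_binom_coef : b \isn't a Num.int ->
  usual_norm R (binom_coef b n) `^ n%:R^-1 @[n --> \oo] --> (1 : R).
Proof.
move=> bZ; apply: cvg_root_of_ratio => // [n|].
  by rewrite /usual_norm ltr0q normr_gt0 binom_coef_neq0.
(* The ratio [(b - n) / (n + 1)] equals [(b + 1) / (n + 1) - 1], which exhibits its limit. *)
have -> : (fun n => usual_norm R (binom_coef b n.+1) / usual_norm R (binom_coef b n)) =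
    (fun n => `|(ratr b + 1) * harmonic n - 1|).
  apply/funext => n; rewrite /usual_norm -fmorph_div /= -normf_div binom_coefS.
  rewrite (mulrAC (binom_coef b n)) divff ?binom_coef_neq0 // mul1r ratr_norm; congr `|_|.
  rewrite fmorph_div rmorphB /= !ratr_nat /harmonic /=; field.
  by rewrite nat1r pnatr_eq0.
have : `|(ratr b + 1) * harmonic n - 1| @[n --> \oo] --> `|(ratr b + 1) * 0 - 1 : R|.
  apply: cvg_norm; apply: cvgB; last exact: cvg_cst.
  by apply: cvgM; [exact: cvg_cst|exact: cvg_harmonic].
by rewrite mulr0 sub0r normrN normr1.
Qed.

Lemma radius_binom_coef_usual : b \isn't a Num.int ->
  radius_of_convergence (@usual_norm R) (binom_coef b) = 1%E.
Proof.
move=> bZ; rewrite /radius_of_convergence.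
suff /cvg_limn_einf_sup[_ ->] :
    (usual_norm R (binom_coef b n) `^ n%:R^-1)%:E @[n --> \oo] --> 1%:E.
  by rewrite inve1.
by apply: cvg_EFin; [exact: nearW|exact: cvg_root_binom_coef].
Qed.

Lemma cvg_in_R_binom_coef (x : rat) : b \isn't a Num.int -> `|x| < 1 ->
  cvg_in_R R (binom_coef b) x.
Proof.
move=> bZ x1; rewrite /cvg_in_R.
have -> : (fun n => ratr (binom_coef b n * x ^+ n) : R) =
    (fun n => ratr (binom_coef b n) * ratr x ^+ n).
  by apply/funext => n; rewrite rmorphM rmorphXn.
apply: (@cvg_power_series _ _ 1); last by rewrite mul1r -ratr_norm -(rmorph1 ratr) ltr_rat.
under eq_fun do rewrite -ratr_norm; exact: cvg_root_binom_coef.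
Qed.

Variables (p : nat) (p_pr : prime p).

Lemma radius_binom_coef_padic : padic_abs p b <= 1 -> b \isn't a Num.int ->
  radius_of_convergence (@padic_norm R p) (binom_coef b) = 1%E.
Proof.
move=> b1 bZ; rewrite /radius_of_convergence (@limn_esup_attained _ _ 1%E) ?inve1 //.
  move=> n; rewrite lee_fin -[leRHS](congr1 (@^~ n%:R^-1) (powR1 R)) ge0_ler_powR ?nnegrE //.
    by rewrite ler0q padic_abs_ge0.
  by rewrite -[X in _ <= X](rmorph1 ratr) ler_rat padic_abs_binom_coef_le1.
move=> N; have [n Nn n1] := padic_abs_binom_coef_inf p_pr N b1 bZ.
by exists n => //; rewrite /padic_norm n1 rmorph1 powR1.
Qed.

(** The coefficients have absolute value at most 1, so the terms are dominated by powers of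
    [padic_abs p x] and tend to 0. *)
Lemma cvg_in_Qp_binom_coef (x : rat) : padic_abs p b <= 1 ->
  padic_abs p x < 1 -> cvg_in_Qp R p_pr (binom_coef b) x.
Proof.
move=> b1 x1; pose a n := binom_coef b n * x ^+ n.
have a0 e : 0 < e -> exists N, forall n, (N <= n)%N -> padic_abs p (a n) < e.
  move=> e0; have ax : `|padic_abs p x| < 1 by rewrite ger0_norm ?padic_abs_ge0.
  have := @cvg_geometric rat 1 _ ax => /cvgr0Pnorm_lt/(_ e e0)[N _ HN].
  exists N => n /HN /=; rewrite mul1r normrX ger0_norm ?padic_abs_ge0 //.
  apply: le_lt_trans; rewrite /a padic_absM // (padic_absX p_pr).
  by rewrite ler_piMl ?exprn_ge0 ?padic_abs_ge0 ?padic_abs_binom_coef_le1.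
have := Qp_cvgn_class R (CauchySeq (padic_cauchy_series p_pr a0)).
rewrite /cvg_in_Qp /=; congr Qp_cvgn; apply/funext => n.
rewrite /series /= Qp_ratrE !rmorph_sum; apply: eq_bigr => k _.
by rewrite Qp_ratrE.
Qed.

End BinomialCoefficients.

Theorem theorem4p3 (R : realType) (p : nat) (p_pr : prime p) (b : rat)
    (b_Zp : padic_integers R (ratr b : Qp p_pr)) (b_nint : b \isn't a Num.int) :
  (radius_of_convergence (@usual_norm R) (binom_coef b) = 1%E /\
   radius_of_convergence (@padic_norm R p) (binom_coef b) = 1%E) /\
  (let S := [set x : rat | exists u v : int,
     [/\ x = u%:~R / v%:~R, coprimez u v, `|u| <= `|v|,
         (p%:Z %| u)%Z & ~~ (p%:Z %| v)%Z]] in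
   [set x : rat | (`|x| < 1 /\ cvg_in_R R (binom_coef b) x) /\
                  (padic_abs p x < 1 /\ cvg_in_Qp R p_pr (binom_coef b) x)] = S /\
   [set x : rat | `|x| < 1] `&` [set x : rat | padic_abs p x < 1] = S).
Proof.
have b1 : padic_abs p b <= 1.
  by move: b_Zp; rewrite /padic_integers /= Qp_norm_ratr -[X in _ <= X](rmorph1 ratr) ler_rat.
split; first by split; [exact: radius_binom_coef_usual|exact: radius_binom_coef_padic].
move=> S.
(* The two unit balls are compared with [S] first; convergence holds at all their common points and
   is added at the end. *)
have SE : [set x : rat | `|x| < 1] `&` [set x : rat | padic_abs p x < 1] = S.
  apply/seteqP; split=> [x [/= x1 xp]|x [u [v [-> cop uv pu pv]]]].
    have cop : coprimez (numq x) (denq x) by rewrite coprimezE coprime_num_den.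
    have pn : (p%:Z %| numq x)%Z.
      by rewrite -(padic_abs_frac_lt1 p_pr _ cop) ?denq_neq0 // divq_num_den.
    exists (numq x), (denq x); split=> //.
    - by rewrite divq_num_den.
    - move: x1; rewrite -{1}(divq_num_den x) normf_div ltr_pdivrMr ?mul1r.
        by rewrite -!intr_norm ltr_int => /ltW.
      by rewrite normr_gt0 intr_eq0 denq_neq0.
    - exact: coprimez_prime_dvd pn.
  have v0 : v != 0 by apply: contraNneq pv => ->; rewrite dvdz0.
  split=> /=; last by rewrite padic_abs_frac_lt1.
  rewrite normf_div ltr_pdivrMr ?normr_gt0 ?intr_eq0 // mul1r -!intr_norm ltr_int.
  (* Equality of [|u|] and [|v|] would make [p] divide [v], so the weak inequality defining [S] is
     in fact strict. *)
  rewrite lt_neqAle uv andbT; apply: contraNneq pv => uv_eq.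
  suff Euv : `|u|%N = `|v|%N by move: pu; rewrite !dvdzE Euv.
  by apply/eqP; rewrite -eqz_nat !abszE; apply/eqP.
split=> //; rewrite -SE; apply/seteqP; split=> x /= [].
  by move=> [? _] [].
by move=> x1 xp; do 2!split=> //; [exact: cvg_in_R_binom_coef|exact: cvg_in_Qp_binom_coef].
Qed.
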